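(* Let $\Gamma$ be a connected $k$-regular graph that is not complete, and let $\theta_0=k>\theta_1>\cdots>\theta_D$ be the distinct eigenvalues of its adjacency matrix. Then $(\theta_1+1)(\theta_D+1)\leq -\beta_1(x)$ for every vertex $x$ of $\Gamma$. Equality holds for all vertices $x$ if and only if $\Gamma$ is strongly regular.
   Context: For a vertex $x$, let $\Gamma_i(x)$ be the set of vertices at path-length distance $i$ from $x$, $0\le i\le D_x$, where $D_x$ is the largest distance from $x$. Let $S$ be the $|V(\Gamma)|\times(D_x+1)$ matrix whose $i$-th column is the characteristic vector of $\Gamma_i(x)$, and define the quotient matrix $B(x)$ by $S^TSB(x)=S^TAS$, where $A$ is the adjacency matrix; thus $B(x)_{ij}$ is the average number of neighbours in $\Gamma_j(x)$ of a vertex in $\Gamma_i(x)$. Then $\beta_1(x)=B(x)_{1,2}$, i.e. $\beta_1(x)=\frac{1}{k}\,\#\{(y,z): y\in\Gamma_1(x), z\in\Gamma_2(x), y\sim z\}$. A strongly regular graph is a distance-regular graph of diameter two. *)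

(* Defs.v *)
From HB Require Import structures.
From mathcomp Require Import all_boot all_order all_algebra.

Set Implicit Arguments.
Unset Strict Implicit.
Unset Printing Implicit Defensive.

Import Order.TTheory GRing.Theory Num.Theory.
Local Open Scope ring_scope.

Section Graph.
Context {T : finType}.
Implicit Types (e : rel T) (x y z : T) (i k n : nat).

Definition simple_graph e : Prop := symmetric e /\ irreflexive e.

Definition connected_graph e : Prop := forall x y, connect e x y.

Definition complete_graph e : Prop := forall x y, x != y -> e x y.

Definition regular_graph e k : Prop := forall x, #|[set y | e x y]| = k.

Definition walk e n x y : bool :=
  [exists p : n.-tuple T, path e x p && (last x p == y)].

(* A shortest walk has fewer than #|T| edges; the value is #|T| when y cannot *)
(* be reached from x.                                                         *)
Definition gdist e x y : nat :=
  find (fun n => walk e n x y) (iota 0 #|T|).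

Definition sphere e i x : {set T} := [set y | gdist e x y == i].

Definition ecc e x : nat := (\max_(y : T) gdist e x y)%N.

Definition diameter e : nat := (\max_(x : T) ecc e x)%N.

(* c, a, b are the intersection numbers c_i, a_i, b_i, with i = d(x, y); the  *)
(* condition d(x, z) + 1 = i avoids the truncated i - 1 at i = 0.             *)
Definition distance_regular e : Prop :=
  [/\ simple_graph e, connected_graph e &
   exists c a b : nat -> nat, forall x y, let i := gdist e x y in
     [/\ #|[set z | e y z & (gdist e x z).+1 == i]| = c i,
         #|[set z | e y z & gdist e x z == i]| = a i &
         #|[set z | e y z & gdist e x z == i.+1]| = b i]].

Definition strongly_regular e : Prop :=
  distance_regular e /\ diameter e = 2%N.

Section Matrices.
Variable R : numFieldType.

Definition adj_mx e : 'M[R]_#|T| :=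
  \matrix_(u, v) (e (enum_val u) (enum_val v))%:R.

Definition sphere_mx e x : 'M[R]_(#|T|, (ecc e x).+1) :=
  \matrix_(u, i) (enum_val u \in sphere e i x)%:R.

(* The solution B of S^T S B = S^T A S, cf. quotient_mxP. *)
Definition quotient_mx e x : 'M[R]_((ecc e x).+1) :=
  let S := sphere_mx e x in
  invmx (S^T *m S) *m (S^T *m adj_mx e *m S).

(* Meaningful when ecc e x >= 2, which holds at every vertex of a connected   *)
(* regular graph that is not complete.                                        *)
Definition beta1 e x : R := quotient_mx e x (inord 1) (inord 2).

End Matrices.

Lemma walkP e n x y :
  reflect (exists2 p, size p = n & path e x p /\ last x p = y) (walk e n x y).
Proof.
apply: (iffP existsP) => [[p /andP[ep /eqP lp]]|[p sp [ep lp]]].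
  by exists p; rewrite ?size_tuple.
have sp' : size p == n by apply/eqP.
by exists (Tuple sp'); rewrite /= ep lp eqxx.
Qed.

Lemma gdist_le e n x y : walk e n x y -> (gdist e x y <= n)%N.
Proof.
move=> w; rewrite /gdist; case: (ltnP n #|T|) => nT.
  rewrite leqNgt; apply/negP => /(before_find 0%N).
  by rewrite nth_iota // add0n w.
by apply: leq_trans nT; rewrite -[X in (_ <= X)%N](size_iota 0) find_size.
Qed.

Lemma gdist_lt e x y : connect e x y -> (gdist e x y < #|T|)%N.
Proof.
case/connectP => p0 /shortenP[p ep up _] ->.
apply: leq_ltn_trans (gdist_le (n := size p) _) _.
  by apply/walkP; exists p.
by rewrite -[(size p).+1]/(size (x :: p)) -(card_uniqP up) max_card.
Qed.

Lemma gdist_walk e x y : connect e x y -> walk e (gdist e x y) x y.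
Proof.
move=> /gdist_lt lt; have := lt; rewrite /gdist -{2}(size_iota 0 #|T|) -has_find.
by move=> /(nth_find 0%N); rewrite nth_iota.
Qed.

Lemma sphere_neq0 e x i :
  connected_graph e -> (i <= ecc e x)%N -> (0 < #|sphere e i x|)%N.
Proof.
move=> ec; have [|y0 E] := @bigop.eq_bigmax T (gdist e x).
  by apply/card_gt0P; exists x.
rewrite /ecc E => le_i; have /walkP[p sp [ep lp]] := gdist_walk (ec x y0).
apply/card_gt0P; exists (last x (take i p)); rewrite inE.
move: ep lp; rewrite -{1 2}(cat_take_drop i p) cat_path last_cat => /andP[e1 e2] l.
set z := last x (take i p) in e2 l *.
have szt : size (take i p) = i by rewrite size_takel ?sp.
rewrite eqn_leq; apply/andP; split.
  by apply: gdist_le; apply/walkP; exists (take i p).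
have /walkP[q sq [eq lq]] := gdist_walk (ec x z).
have : (gdist e x y0 <= gdist e x z + (gdist e x y0 - i))%N.
  apply: gdist_le; apply/walkP; exists (q ++ drop i p).
    by rewrite size_cat sq size_drop sp.
  by rewrite cat_path last_cat eq lq.
by rewrite addnC -leq_subLR subKn.
Qed.

Section MatrixFacts.
Variable R : numFieldType.

Lemma sum_enum_val (F : T -> R) :
  \sum_(u < #|T|) F (enum_val u) = \sum_(y : T) F y.
Proof. by rewrite -(big_enum_val (A := T) F). Qed.

Lemma sphere_gram e x :
  (sphere_mx R e x)^T *m sphere_mx R e x =
  diag_mx (\row_i #|sphere e i x|%:R).
Proof.
apply/matrixP => i j; rewrite !mxE.
transitivity (\sum_(y : T) (y \in sphere e i x)%:R * (y \in sphere e j x)%:R : R).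
  by rewrite -sum_enum_val; apply: eq_bigr => u _; rewrite !mxE.
case: (eqVneq i j) => [<-|nij].
  rewrite mulr1n -sum1_card natr_sum [RHS]big_mkcond; apply: eq_bigr => y _.
  by case: ifP => _; rewrite ?mulr1 ?mulr0.
rewrite mulr0n big1 // => y _; rewrite !inE.
case: eqP => [->|_]; last by rewrite mul0r.
by rewrite (inj_eq val_inj) (negPf nij) mulr0.
Qed.

Lemma sphere_adjE e x (i j : 'I_(ecc e x).+1) :
  ((sphere_mx R e x)^T *m adj_mx R e *m sphere_mx R e x) i j =
  #|[set yz : T * T | [&& yz.1 \in sphere e i x, yz.2 \in sphere e j x
                        & e yz.1 yz.2]]|%:R.
Proof.
transitivity (\sum_(y : T) \sum_(z : T)
    [&& y \in sphere e i x, z \in sphere e j x & e y z]%:R : R).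
  rewrite mxE [RHS]exchange_big -sum_enum_val.
  apply: eq_bigr => v _; rewrite !mxE mulr_suml -sum_enum_val.
  apply: eq_bigr => u _; rewrite !mxE.
  rewrite -!natrM; congr _%:R; rewrite !mulnb; congr nat_of_bool.
  by rewrite -andbA; congr (_ && _); rewrite andbC.
rewrite pair_big -sum1_card natr_sum [RHS]big_mkcond /=.
by apply: eq_bigr => -[y z] _; rewrite !inE /=; case: ifP.
Qed.

Lemma quotient_mxP e x : connected_graph e ->
  let S := sphere_mx R e x in
  S^T *m S *m quotient_mx R e x = S^T *m adj_mx R e *m S.
Proof.
move=> ec S; rewrite /quotient_mx -/S mulmxA mulmxV ?mul1mx //.
rewrite unitmxE /S sphere_gram det_diag unitfE.
apply/prodf_neq0 => i _; rewrite mxE pnatr_eq0 -lt0n.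
by apply: sphere_neq0 => //; rewrite -ltnS.
Qed.

Lemma beta1E e x k : simple_graph e -> connected_graph e -> regular_graph e k ->
    (2 <= ecc e x)%N ->
  beta1 R e x =
    #|[set yz : T * T | [&& yz.1 \in sphere e 1 x, yz.2 \in sphere e 2 x
                          & e yz.1 yz.2]]|%:R / k%:R.
Proof.
move=> [_ irr] ec ek le2.
have v1 : (inord 1 : 'I_(ecc e x).+1) = 1%N :> nat by rewrite inordK // ltnS ltnW.
have v2 : (inord 2 : 'I_(ecc e x).+1) = 2%N :> nat by rewrite inordK.
have := congr1 (fun M : 'M__ => M (inord 1) (inord 2)) (quotient_mxP x ec).
rewrite /= sphere_adjE v1 v2 sphere_gram mul_diag_mx mxE -/(beta1 R e x) mxE v1 => <-.
have c1 : #|sphere e 1 x| = k.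
  rewrite -(ek x); apply: eq_card => y; rewrite !inE.
  have xx : gdist e x x = 0%N.
    by apply/eqP; rewrite -leqn0; apply: gdist_le; apply/walkP; exists [::].
  apply/eqP/idP => [d1|exy].
    have := gdist_walk (ec x y); rewrite d1.
    by case/walkP=> -[|z [|//]] // _ [/= /andP[exz _] <-].
  apply/eqP; rewrite eqn_leq; apply/andP; split.
    by apply: gdist_le; apply/walkP; exists [:: y] => //=; rewrite exy.
  rewrite lt0n; apply/eqP => d0.
  have /walkP[p sp [_ lp]] := gdist_walk (ec x y).
  by move: sp lp exy; rewrite d0 => /size0nil -> /= <-; rewrite irr.
rewrite c1 mulrAC mulfV ?mul1r // pnatr_eq0 -lt0n -c1.
by apply: sphere_neq0 => //; rewrite ltnW.
Qed.

End MatrixFacts.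

End Graph.

(* Main.v *)
Require Import Defs.
From mathcomp Require Import all_boot all_order all_algebra.
From mathcomp Require Import complex ring lra.

(* Let A be the adjacency matrix, n the number of vertices and m = n - 1 - k. *)
(* The eigenvalue k is simple, so (A - theta_1)(A - theta_D) is negative      *)
(* semidefinite on the orthogonal complement of the all-one vector 1.         *)
(* Evaluate this form at the two vectors e_x - 1/n and k e_x - A e_x of that  *)
(* complement. In a suitable positive combination of the two inequalities     *)
(* the terms linear in theta_1 + theta_D cancel, and what remains is          *)
(*   V / k + (beta_1(x) + (theta_1 + 1)(theta_D + 1)) K <= 0     with K > 0,  *)
(* where V >= 0 is the sum of squared deviations, over y <> x, of the number  *)
(* of common neighbours of x and y from its mean over the neighbours, resp.   *)
(* non-neighbours, of x. Equality forces V = 0, so these numbers are          *)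
(* constant. Conversely, in a strongly regular graph theta_1 and theta_D are  *)
(* roots of the same quadratic, and the inequality shows theta_1 <> theta_D.  *)

Set Implicit Arguments.
Unset Strict Implicit.
Unset Printing Implicit Defensive.

Import Order.TTheory GRing.Theory Num.Theory.
Local Open Scope ring_scope.

(** Everything rests on [spectral_gap_form_le0]: a function with sum zero has no component on the
    eigenvalue k, and on every other eigenvalue d the product (d - theta_1)(d - theta_D) is
    nonpositive. Double counting the edges that leave the neighbourhood of x expresses both means
    through beta_1(x), so the squares in [neighbour_form] can be completed around them;
    [local_deviation_bound] combines this with [vertex_form]. In the equality case the
    common-neighbour counts are determined by (theta_1 + 1)(theta_D + 1), which does not depend on
    x, so they agree at all vertices and [strongly_regular_of_common] applies. The converse is Vieta
    for the quadratic of [eigenfunction_quadratic]. *)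

(** * Spectral theorem for real symmetric matrices *)

Section Spectral.
Local Open Scope sesquilinear_scope.

(** Diagonalize over the complex numbers: [c i] is the squared modulus of the coordinate of [v] on
    the [i]-th unitary eigenvector. If it is nonzero, the real or the imaginary part of that vector
    is a real eigenvector not orthogonal to [v]. *)
Lemma spectral_decomposition (R : rcfType) n (A : 'M[R]_n) (v : 'rV[R]_n) :
    A^T = A ->
  exists d c : 'I_n -> R,
  [/\ forall i, 0 <= c i,
      forall i, c i != 0 ->
        exists2 w : 'rV_n, w *m A = d i *: w & (v *m w^T) 0 0 != 0 &
      forall s t, ((v *m A - s *: v) *m (v *m A - t *: v)^T) 0 0 =
        \sum_i c i * ((d i - s) * (d i - t))].
Proof.
move=> symA.
have fJ m p (M : 'M[R]_(m, p)) :
    map_mx Num.conj (map_mx (real_complex R) M) = map_mx (real_complex R) M.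
  by apply/matrixP=> i j; rewrite !mxE; apply: conjc_real.
have hermB : map_mx (real_complex R) A \is hermsymmx.
  apply/is_hermitianmxP; rewrite expr0 scale1r map_trmx symA.
  by rewrite fJ.
have /orthomx_spectralP := hermitian_normalmx hermB.
set P := spectralmx _; set D := spectral_diag _ => defB.
have uP : P \is unitarymx by apply: spectral_unitarymx.
have /mxOverP rD := hermitian_spectral_diag_real hermB.
rewrite invmx_unitary // in defB.
pose d i := complex.Re (D 0 i).
have dE i : D 0 i = (d i)%:C%C by rewrite RRe_real //; apply: rD.
pose wr (i : 'I_n) : 'rV[R]_n := \row_j complex.Re (P i j).
pose wi (i : 'I_n) : 'rV[R]_n := \row_j complex.Im (P i j).
have PB i j : \sum_k P i k * (A k j)%:C%C = (d i)%:C%C * P i j.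
  have : P *m map_mx (real_complex R) A = diag_mx D *m P.
    by rewrite defB !mulmxA (unitarymxP uP) mul1mx.
  move/matrixP/(_ i j); rewrite mul_diag_mx !mxE dE => <-.
  by apply: eq_bigr => k _; rewrite mxE.
(* [A] and [d i] are real, so the eigenvector equation [PB] splits into real and imaginary parts. *)
have wrE i : wr i *m A = d i *: wr i.
  apply/rowP=> j; have := congr1 (@complex.Re R) (PB i j).
  rewrite (raddf_sum (@complex.Re R : Rcomplex R -> R)) !mxE /=.
  rewrite (_ : complex.Re (_ * _) = d i * complex.Re (P i j)); last first.
    by case: (P i j) => a b /=; rewrite mul0r subr0.
  move=> <-; apply: eq_bigr => k _; rewrite !mxE.
  by case: (P i k) => a b /=; rewrite mulr0 subr0.
have wiE i : wi i *m A = d i *: wi i.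
  apply/rowP=> j; have := congr1 (@complex.Im R) (PB i j).
  rewrite (raddf_sum (@complex.Im R : Rcomplex R -> R)) !mxE /=.
  rewrite (_ : complex.Im (_ * _) = d i * complex.Im (P i j)); last first.
    by case: (P i j) => a b /=; rewrite mul0r addr0.
  move=> <-; apply: eq_bigr => k _; rewrite !mxE.
  by case: (P i k) => a b /=; rewrite mulr0 add0r.
pose yr i : R := (v *m (wr i)^T) 0 0; pose yi i : R := (v *m (wi i)^T) 0 0.
exists d, (fun i => yr i ^+ 2 + yi i ^+ 2); split.
- by move=> i; rewrite addr_ge0 ?sqr_ge0.
- move=> i; case: (eqVneq (yr i) 0) => [-> c0|yr0 _]; last by exists (wr i).
  exists (wi i) => //; apply: contra_neq c0 => /= yi0.
  by rewrite /yi yi0 expr0n addr0.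
move=> s t.
pose y := map_mx (real_complex R) v *m P ^t*.
have yE i : y 0 i = (yr i -i* yi i)%C.
  rewrite /y /yr /yi !mxE (complexE (\sum_ _ _)) /=.
  rewrite (raddf_sum (@complex.Re R : Rcomplex R -> R)).
  rewrite (raddf_sum (@complex.Im R : Rcomplex R -> R)) /=.
  have -> : \sum_j complex.Re (map_mx (real_complex R) v 0 j * (P ^t*) j i) =
    \sum_j v 0 j * (wr i)^T j 0.
    apply: eq_bigr => j _; rewrite !mxE.
    by case: (P i j) => a b /=; rewrite mul0r subr0.
  have -> : \sum_j complex.Im (map_mx (real_complex R) v 0 j * (P ^t*) j i) =
    - \sum_j v 0 j * (wi i)^T j 0.
    rewrite -sumrN; apply: eq_bigr => j _; rewrite !mxE.
    by case: (P i j) => a b /=; rewrite mul0r addr0 mulrN.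
  by simpc.
have shiftE r : map_mx (real_complex R) (v *m A - r *: v) *m P ^t* =
    \row_i (y 0 i * (d i - r)%:C%C).
  rewrite map_mxB map_mxM map_mxZ mulmxBl -scalemxAl -/y defB !mulmxA -/y.
  rewrite mulmxtVK //; apply/rowP=> i; rewrite mul_mx_diag !mxE dE rmorphB /=.
  by rewrite mulrBr [r%:C%C * _]mulrC.
clearbody y; apply: complexI.
(* The unitary change of basis preserves inner products. *)
have -> : (((v *m A - s *: v) *m (v *m A - t *: v)^T) 0 0)%:C%C =
  (map_mx (real_complex R) (v *m A - s *: v) *m P ^t* *m
   (map_mx (real_complex R) (v *m A - t *: v) *m P ^t* ) ^t* ) 0 0.
  rewrite trmx_mul map_mxM trmxCK mulmxA mulmxKtV // map_trmx fJ -map_mxM.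
  by rewrite [in RHS]mxE.
rewrite !shiftE mxE rmorph_sum /=; apply: eq_bigr => i _; rewrite !mxE yE.
by apply/eqP; rewrite eq_complex /=; apply/andP; split; apply/eqP; ring.
Qed.

End Spectral.

(** * The eigenvalue k and the spectral gap *)

(** For [D = 0] the entry of [s] at index 1 is the default 0, but then no [a] satisfies the
    hypotheses. *)
Lemma sorted_gt_bounds (R : realDomainType) (D : nat) (s : D.+1.-tuple R)
    (a : R) :
  sorted >%R s -> a \in s -> a != s`_0 -> s`_D <= a <= s`_1.
Proof.
move=> s_decr /(nthP 0)[i lt_i <-] ai0.
have s_noninc : sorted >=%R s by apply: sub_sorted s_decr => x y /ltW.
have le_nth := sorted_leq_nth ge_trans ge_refl 0 s_noninc.
rewrite size_tuple in lt_i le_nth.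
case: i => [|i] in lt_i ai0 *; first by rewrite eqxx in ai0.
by apply/andP; split; apply: le_nth; rewrite ?inE // (leq_trans _ lt_i).
Qed.

Definition common {T : finType} (e : rel T) x y : nat :=
  #|[set z | e x z & e y z]|.

Section RegularGraph.
Variables (R : rcfType) (T : finType) (e : rel T) (k : nat).
Hypotheses (e_simple : simple_graph e) (e_connected : connected_graph e).
Hypothesis e_regular : regular_graph e k.
Implicit Types (f : T -> R) (x y z : T).

Let e_sym : symmetric e. Proof. by case: e_simple. Qed.

Lemma degreeE x : \sum_y (e x y)%:R = k%:R :> R.
Proof.
rewrite -(e_regular x) -sum1_card natr_sum [RHS]big_mkcond.
by apply: eq_bigr => y _; rewrite inE; case: (e x y).
Qed.

Lemma commonE x y : (common e x y)%:R = \sum_z (e x z)%:R * (e y z)%:R :> R.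
Proof.
rewrite /common -sum1_card natr_sum [LHS]big_mkcond.
by apply: eq_bigr => z _; rewrite inE -natrM mulnb; case: ifP.
Qed.

(** Zero Dirichlet energy makes [f] constant along edges, and connectedness does the rest: the
    eigenvalue k is simple. *)
Lemma degree_eigenvector_constant f :
    (forall y, \sum_z (e y z)%:R * f z = k%:R * f y) ->
  forall x y, f x = f y.
Proof.
move=> fk x y.
(* The Dirichlet energy of f is 2 <f, (k - A) f>.                             *)
have dirichlet : \sum_y \sum_z (e y z)%:R * (f y - f z) ^+ 2 = 0.
  transitivity (2 * \sum_y (k%:R * f y * f y - f y * \sum_z (e y z)%:R * f z)).
    have sw : \sum_y \sum_z (e y z)%:R * (f z) ^+ 2 = \sum_y k%:R * f y * f y.
      rewrite exchange_big; apply: eq_bigr => z _ /=.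
      rewrite -(degreeE z) -mulrA !mulr_suml; apply: eq_bigr => u _.
      by rewrite e_sym expr2.
    rewrite mulr_sumr.
    rewrite (eq_bigr (fun y =>
      (k%:R * f y * f y - 2 * (f y * \sum_z (e y z)%:R * f z))
       + \sum_z (e y z)%:R * (f z) ^+ 2)); last first.
      move=> u _; rewrite -(degreeE u) -mulrA !mulr_suml !mulr_sumr.
      rewrite -sumrB -big_split /=.
      by apply: eq_bigr => z _; ring.
    rewrite big_split /= sw -big_split /=; apply: eq_bigr => u _; ring.
  by rewrite big1 ?mulr0 // => u _; rewrite fk; ring.
have step u z : e u z -> f u = f z.
  move=> euz; have ge0 w : 0 <= \sum_z (e w z)%:R * (f w - f z) ^+ 2.
    by apply: sumr_ge0 => z' _; rewrite mulr_ge0 ?ler0n ?sqr_ge0.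
  have := psumr_eq0P (fun w _ => ge0 w) dirichlet (i := u) isT.
  move/psumr_eq0P => /(_ _ z isT); rewrite euz mul1r => /(_ _)/eqP.
  rewrite sqrf_eq0 subr_eq0 => H; apply/eqP/H => z' _.
  by rewrite mulr_ge0 ?ler0n ?sqr_ge0.
case/connectP: (e_connected x y) => p ep ->.
elim: p x ep => //= z p IHp x /andP[/step -> ep]; exact: IHp.
Qed.

Variables (D : nat) (theta : D.+1.-tuple R).
Hypothesis theta_decr : sorted >%R theta.
Hypothesis theta_eig : forall a : R, (a \in theta) = eigenvalue (adj_mx R e) a.
Hypothesis theta_0 : theta`_0 = k%:R.

Lemma adj_mxE f u :
  ((\row_v f (enum_val v)) *m adj_mx R e) 0 u =
  \sum_z (e (enum_val u) z)%:R * f z.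
Proof.
rewrite mxE -[RHS]sum_enum_val; apply: eq_bigr => v _.
by rewrite !mxE e_sym mulrC.
Qed.

Lemma adj_mx_eigenvector (w : 'rV_#|T|) a : w *m adj_mx R e = a *: w ->
  forall y, \sum_z (e y z)%:R * w 0 (enum_rank z) = a * w 0 (enum_rank y).
Proof.
move=> wE y; have -> : a * w 0 (enum_rank y) = (a *: w) 0 (enum_rank y).
  by rewrite mxE.
rewrite -wE -{1}(enum_rankK y) -adj_mxE; congr ((_ *m _) _ _).
by apply/rowP=> u; rewrite mxE enum_valK.
Qed.

Lemma spectral_gap_form_le0 f : \sum_y f y = 0 ->
  \sum_y (\sum_z (e y z)%:R * f z - theta`_1 * f y) *
         (\sum_z (e y z)%:R * f z - theta`_D * f y) <= 0.
Proof.
move=> f0.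
have symA : (adj_mx R e)^T = adj_mx R e.
  by apply/matrixP=> u v; rewrite !mxE e_sym.
have [d [c [c_ge0 c_eig formE]]] :=
  @spectral_decomposition _ _ _ (\row_v f (enum_val v)) symA.
rewrite (_ : \sum_y _ = \sum_i c i * ((d i - theta`_1) * (d i - theta`_D))).
  rewrite -oppr_ge0 -sumrN; apply: sumr_ge0 => i _.
  have [->|ci] := eqVneq (c i) 0; first by rewrite mul0r oppr0.
  have [w wE w0] := c_eig i ci.
  have d_theta : d i \in theta.
    rewrite theta_eig; apply/eigenvalueP; exists w => //.
    by apply: contra_neq w0 => ->; rewrite trmx0 mulmx0 mxE.
  (* An eigenvector for k is constant, hence orthogonal to [f], while [w] is not. *)
  have dk : d i != theta`_0.
    apply: contra_neq w0; rewrite theta_0 => dk.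
    pose g y := w 0 (enum_rank y).
    have wg : w = \row_v g (enum_val v).
      by apply/rowP=> v; rewrite mxE /g enum_valK.
    have gk y : \sum_z (e y z)%:R * g z = k%:R * g y.
      by rewrite (adj_mx_eigenvector wE) dk.
    have g_const := degree_eigenvector_constant gk.
    rewrite wg mxE.
    under eq_bigr => v _ do rewrite !mxE.
    rewrite (sum_enum_val (fun y => f y * g y)).
    case: (pickP T) => [x0 _|T0]; last by rewrite big1 // => y; have := T0 y.
    under eq_bigr => y _ do rewrite (g_const y x0).
    by rewrite -mulr_suml f0 mul0r.
  have /andP[ge_d le_d] := sorted_gt_bounds theta_decr d_theta dk.
  rewrite -mulrN mulr_ge0 // -mulNr opprB mulr_ge0 // subr_ge0 //.
rewrite -formE mxE -[LHS]sum_enum_val; apply: eq_bigr => u _.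
rewrite [in RHS]mxE -!adj_mxE.
by move: (_ *m _) => M; rewrite !mxE.
Qed.
End RegularGraph.

(** * Small distances in terms of adjacency *)

Section Distance.
Variables (T : finType) (e : rel T).
Hypotheses (e_simple : simple_graph e) (e_connected : connected_graph e).
Implicit Types (x y z : T).

Let e_sym : symmetric e. Proof. by case: e_simple. Qed.
Let e_irr : irreflexive e. Proof. by case: e_simple. Qed.

Lemma gdist_eq0 x y : (gdist e x y == 0%N) = (y == x).
Proof.
apply/eqP/eqP => [d0|->].
  have := gdist_walk (e_connected x y); rewrite d0.
  by case/walkP=> -[|//] _ [_ <-].
by apply/eqP; rewrite -leqn0; apply: gdist_le; apply/walkP; exists [::].
Qed.

Lemma gdist_eq1 x y : (gdist e x y == 1%N) = e x y.
Proof.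
apply/eqP/idP => [d1|exy].
  have := gdist_walk (e_connected x y); rewrite d1.
  by case/walkP=> -[|z [|//]] // _ [/= /andP[exz _] <-].
apply/eqP; rewrite eqn_leq lt0n gdist_eq0; apply/andP; split.
  by apply: gdist_le; apply/walkP; exists [:: y] => //=; rewrite exy.
by apply: contraTneq exy => ->; rewrite e_irr.
Qed.

Lemma gdist_eq2 x y :
  (gdist e x y == 2%N) = [&& y != x, ~~ e x y & 0 < common e x y]%N.
Proof.
apply/idP/and3P => [/eqP d2|[yx nexy /card_gt0P[z]]].
  split; first by rewrite -gdist_eq0 d2.
    by rewrite -gdist_eq1 d2.
  have := gdist_walk (e_connected x y); rewrite d2.
  case/walkP=> -[|z [|u [|//]]] // _ [/= /and3P[exz ezu _] <-].
  by apply/card_gt0P; exists z; rewrite inE exz e_sym.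
rewrite inE => /andP[exz eyz]; rewrite eqn_leq; apply/andP; split.
  apply: gdist_le; apply/walkP; exists [:: z; y] => //=.
  by rewrite exz e_sym eyz.
move: yx nexy; rewrite -gdist_eq0 -gdist_eq1.
by case: gdist => [|[]].
Qed.

(** The third cell holds all vertices at distance at least two, not only those at distance two. *)
Lemma sum_by_adjacency (V : nmodType) (F : T -> V) x :
  \sum_y F y = F x + \sum_(y | e x y) F y + \sum_(y | (y != x) && ~~ e x y) F y.
Proof.
rewrite (bigD1 x) //= (bigID (e x)) /= addrA; congr (_ + _ + _).
by apply: eq_bigl => y; case: eqVneq => [->|]; rewrite // e_irr.
Qed.
End Distance.

(** * Double counts for beta_1 and the two test vectors *)

Section TestVectors.
Variables (R : rcfType) (T : finType) (e : rel T) (k : nat).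
Hypotheses (e_simple : simple_graph e) (e_connected : connected_graph e).
Hypothesis e_regular : regular_graph e k.
Hypothesis e_not_complete : ~ complete_graph e.
Implicit Types (x y z : T).

Let e_sym : symmetric e. Proof. by case: e_simple. Qed.
Let e_irr : irreflexive e. Proof. by case: e_simple. Qed.

(** This is m, the degree in the complement graph, taken in [R] so that no subtraction is
    truncated. *)
Definition codegree : R := #|T|%:R - 1 - k%:R.

Lemma sum_neighbours1 x : \sum_(y | e x y) 1 = k%:R :> R.
Proof.
rewrite -(degreeE R e_regular x) [LHS]big_mkcond.
by apply: eq_bigr => y _; case: (e x y).
Qed.

Lemma sum_nonneighbours1 x : \sum_(y | (y != x) && ~~ e x y) 1 = codegree.
Proof.
rewrite /codegree -(sum_neighbours1 x) -sum1_card natr_sum.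
by rewrite (sum_by_adjacency e_simple _ x) mulr1n; ring.
Qed.

Lemma codegree_gt0 : 0 < codegree.
Proof.
have /existsP[x /existsP[y /andP[yx nexy]]] :
    [exists x, exists y, (y != x) && ~~ e x y].
  apply: contra_notT e_not_complete => /existsPn H x y xy.
  by have /existsPn/(_ y) := H x; rewrite eq_sym xy negbK.
rewrite -(sum_nonneighbours1 x) (bigD1 y) ?yx //=.
by rewrite ltr_pwDl // sumr_ge0.
Qed.

(** By regularity every vertex has m non-neighbours, so one non-adjacent pair yields one at each
    vertex. *)
Lemma nonneighbour_exists x : exists2 y, y != x & ~~ e x y.
Proof.
case: (pickP (fun y => (y != x) && ~~ e x y)) => [y /andP[]|none].
  by exists y.
by have := codegree_gt0; rewrite -(sum_nonneighbours1 x) big_pred0 ?ltxx.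
Qed.

Lemma ecc_ge2 x : (2 <= ecc e x)%N.
Proof.
have [y yx nexy] := nonneighbour_exists x.
apply: leq_trans (leq_bigmax (F := gdist e x) y).
move: yx nexy; rewrite -(gdist_eq0 e_connected).
rewrite -(gdist_eq1 e_simple e_connected).
by case: gdist => [|[]].
Qed.

Lemma degree_gt0 : (0 < k)%N.
Proof.
have [x] : exists x : T, true.
  case: (pickP T) => [x _|T0]; first by exists x.
  by case: e_not_complete => x; have := T0 x.
have /card_gt0P[y] := sphere_neq0 e_connected (ltnW (ecc_ge2 x)).
rewrite inE (gdist_eq1 e_simple e_connected) => exy _; rewrite -(e_regular x).
by apply/card_gt0P; exists y; rewrite inE.
Qed.

Lemma beta1_edges x :
  k%:R * beta1 R e x =
  \sum_(y | e x y) \sum_(z | (z != x) && ~~ e x z) (e y z)%:R.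
Proof.
rewrite (beta1E R e_simple e_connected e_regular (ecc_ge2 x)).
rewrite mulrCA mulfV ?mulr1 ?pnatr_eq0 -?lt0n ?degree_gt0 //.
rewrite pair_big_dep -sum1_card natr_sum big_mkcond [RHS]big_mkcond.
apply: eq_bigr => -[y z] _; rewrite !inE /= (gdist_eq1 e_simple e_connected).
rewrite (gdist_eq2 e_simple e_connected).
case: (boolP (e x y)) => //= exy; case: (z != x) => //=; case: (e x z) => //=.
case: (boolP (e y z)) => eyz; last by rewrite andbF.
(* The common neighbour [y] puts [z] at distance two, so counting edges into all non-neighbours adds
   nothing. *)
rewrite (_ : (0 < _)%N) //; apply/card_gt0P; exists y.
by rewrite inE exy e_sym.
Qed.

(** Of the k neighbours of y, one is x and [common e x y] are adjacent to x. Thus beta_1(x) is a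
    mean over the neighbours of x. *)
Lemma beta1_neighbours x :
  k%:R * beta1 R e x = \sum_(y | e x y) (k%:R - 1 - (common e x y)%:R).
Proof.
rewrite beta1_edges; apply: eq_bigr => y exy.
rewrite -(degreeE R e_regular y) (sum_by_adjacency e_simple _ x) e_sym exy.
have -> : \sum_(z | e x z) (e y z)%:R = (common e x y)%:R :> R.
  rewrite commonE [LHS]big_mkcond; apply: eq_bigr => z _.
  by case: (e x z); rewrite ?mul1r ?mul0r.
rewrite /=; ring.
Qed.

(** The same edges counted from their far ends: k beta_1(x) / m is the mean of [common e x y] over
    the non-neighbours. *)
Lemma beta1_nonneighbours x :
  k%:R * beta1 R e x = \sum_(y | (y != x) && ~~ e x y) (common e x y)%:R.
Proof.
rewrite beta1_edges exchange_big; apply: eq_bigr => y _ /=.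
rewrite commonE big_mkcond; apply: eq_bigr => z _.
by rewrite (e_sym z); case: (e x z); rewrite ?mul1r ?mul0r.
Qed.

Lemma beta1_gt0 x : 0 < beta1 R e x.
Proof.
have k_gt0 : 0 < k%:R :> R by rewrite ltr0n degree_gt0.
rewrite -(pmulr_rgt0 _ k_gt0) beta1_nonneighbours.
have /card_gt0P[y] := sphere_neq0 e_connected (ecc_ge2 x).
rewrite inE (gdist_eq2 e_simple e_connected) => /and3P[yx nexy c0].
rewrite (bigD1 y) ?yx //= ltr_pwDl ?ltr0n // sumr_ge0 // => z _.
Qed.

Variables (D : nat) (theta : D.+1.-tuple R).
Hypothesis theta_decr : sorted >%R theta.
Hypothesis theta_eig : forall a : R, (a \in theta) = eigenvalue (adj_mx R e) a.
Hypothesis theta_0 : theta`_0 = k%:R.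

(* Vanishes exactly when {x}, its neighbours and its non-neighbours form an   *)
(* equitable partition.                                                       *)
Definition local_deviation x : R :=
  \sum_(y | e x y) (k%:R - 1 - (common e x y)%:R - beta1 R e x) ^+ 2 +
  \sum_(y | (y != x) && ~~ e x y)
     ((common e x y)%:R - k%:R * beta1 R e x / codegree) ^+ 2.

Lemma sum_three_cells x (F : T -> R) (cx cn cm : R) :
    F x = cx -> (forall y, e x y -> F y = cn) ->
    (forall y, y != x -> ~~ e x y -> F y = cm) ->
  \sum_y F y = cx + k%:R * cn + codegree * cm.
Proof.
move=> Fx Fn Fm; rewrite (sum_by_adjacency e_simple _ x) Fx.
rewrite (eq_bigr (fun=> cn * 1)) => [|y exy]; last by rewrite mulr1 Fn.
rewrite -mulr_sumr sum_neighbours1 [in RHS](mulrC k%:R); congr (_ + _).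
rewrite (eq_bigr (fun=> cm * 1)) => [|y /andP[yx nexy]].
  by rewrite -mulr_sumr sum_nonneighbours1 mulrC.
by rewrite mulr1 Fm.
Qed.

(* n times the quadratic form at e_x - 1/n.                                   *)
Lemma vertex_form x :
  k.+1%:R * codegree - (theta`_1 + theta`_D + 2) * codegree +
  (theta`_1 + 1) * (theta`_D + 1) * (k%:R + codegree) <= 0.
Proof.
have n0 : 0 < #|T|%:R :> R by rewrite ltr0n; apply/card_gt0P; exists x.
have nE : #|T|%:R = 1 + k%:R + codegree by rewrite /codegree; ring.
pose f y : R := (y == x)%:R - #|T|%:R^-1.
have f0 : \sum_y f y = 0.
  rewrite (sum_three_cells (x := x) (cx := 1 - #|T|%:R^-1)
    (cn := - #|T|%:R^-1) (cm := - #|T|%:R^-1)) /f.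
  - by rewrite nE; field; rewrite -nE gt_eqF.
  - by rewrite eqxx.
  - by move=> y exy; case: eqP exy => [->|_ _]; rewrite ?e_irr ?sub0r.
  - by move=> y /negPf -> _; rewrite sub0r.
have fA y : \sum_z (e y z)%:R * f z = (e x y)%:R - k%:R / #|T|%:R.
  rewrite -(degreeE R e_regular y) mulr_suml.
  rewrite (bigD1 x) //= [in RHS](bigD1 x) //= /f eqxx e_sym opprD addrA.
  rewrite mulrBr mulr1 -sumrN; congr (_ + _); apply: eq_bigr => z /negPf ->.
  by rewrite sub0r mulrN.
have := spectral_gap_form_le0 e_simple e_connected e_regular theta_decr
  theta_eig theta_0 f0.
set a := theta`_1; set b := theta`_D.
rewrite (sum_three_cells (x := x)
  (cx := (- k%:R / #|T|%:R - a * (1 - #|T|%:R^-1)) *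
         (- k%:R / #|T|%:R - b * (1 - #|T|%:R^-1)))
  (cn := (1 - k%:R / #|T|%:R + a / #|T|%:R) *
         (1 - k%:R / #|T|%:R + b / #|T|%:R))
  (cm := (- k%:R / #|T|%:R + a / #|T|%:R) *
         (- k%:R / #|T|%:R + b / #|T|%:R))).
- rewrite -(pmulr_rle0 _ n0); congr (_ <= 0); rewrite -natr1 nE; field.
  by rewrite -nE gt_eqF.
- by rewrite fA /f eqxx e_irr /=; ring.
- move=> y exy; rewrite fA /f exy.
  by case: eqP exy => [->|_ _]; rewrite ?e_irr //=; ring.
- by move=> y /negPf yx /negPf nexy; rewrite fA /f yx nexy /=; ring.
Qed.

(* The quadratic form at k e_x - A e_x, a vector orthogonal to 1.             *)
Lemma neighbour_form x :
  let b := beta1 R e x in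
  local_deviation x + k%:R * b ^+ 2 + (k%:R * b) ^+ 2 / codegree
  + (theta`_1 + theta`_D + 2) * (k%:R * b)
  + (theta`_1 + 1) * (theta`_D + 1) * (k%:R * k.+1%:R) <= 0.
Proof.
set b := beta1 R e x => /=; have m0 := codegree_gt0.
pose f y : R := k%:R * (y == x)%:R - (e x y)%:R.
have f0 : \sum_y f y = 0.
  rewrite sumrB (degreeE R e_regular) (bigD1 x) //= eqxx mulr1.
  rewrite big1 ?addr0 ?subrr //.
  by move=> y /negPf ->; rewrite mulr0.
have fA y : \sum_z (e y z)%:R * f z = k%:R * (e x y)%:R - (common e x y)%:R.
  rewrite commonE (bigD1 x) //= [in RHS](bigD1 x) //= /f eqxx e_sym e_irr.
  rewrite mul0r add0r mulr1 subr0 mulrC -sumrN; congr (_ + _).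
  by apply: eq_bigr => z /negPf ->; rewrite mulr0 sub0r mulrN mulrC.
have := spectral_gap_form_le0 e_simple e_connected e_regular theta_decr
  theta_eig theta_0 f0.
set s := theta`_1; set t := theta`_D.
have fx : f x = k%:R by rewrite /f eqxx e_irr /=; ring.
rewrite (sum_by_adjacency e_simple _ x) /= !fA e_irr fx.
have -> : (common e x x)%:R = k%:R :> R.
  rewrite commonE -(degreeE R e_regular x); apply: eq_bigr => z _.
  by rewrite -natrM mulnb andbb.
(* With u = k - 1 - [common e x y], a neighbour contributes (u + s + 1)(u + t + 1); the square is
   completed around b, the mean of u. *)
have -> : \sum_(y | e x y)
    (\sum_z (e y z)%:R * f z - s * f y) *
    (\sum_z (e y z)%:R * f z - t * f y)
  = \sum_(y | e x y) (k%:R - 1 - (common e x y)%:R - b) ^+ 2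
    + (2 * b + s + t + 2) * (k%:R * b) + k%:R * ((s + 1) * (t + 1) - b ^+ 2).
  rewrite {3}/b beta1_neighbours -[X in _ + _ + X * _](sum_neighbours1 x).
  rewrite [X in _ + _ + X]mulr_suml mulr_sumr -!big_split /=.
  apply: eq_bigr => y exy; rewrite fA /f exy.
  by case: eqP exy => [->|_ _]; rewrite ?e_irr //=; ring.
(* Here [f] vanishes, so s and t drop out; the square is completed around the mean k b / m. *)
have -> : \sum_(y | (y != x) && ~~ e x y)
    (\sum_z (e y z)%:R * f z - s * f y) *
    (\sum_z (e y z)%:R * f z - t * f y)
  = \sum_(y | (y != x) && ~~ e x y)
       ((common e x y)%:R - k%:R * b / codegree) ^+ 2
    + 2 * (k%:R * b / codegree) * (k%:R * b)
    - codegree * (k%:R * b / codegree) ^+ 2.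
  set g := k%:R * b / codegree.
  rewrite /b beta1_nonneighbours -(sum_nonneighbours1 x).
  rewrite mulr_suml mulr_sumr -sumrN -!big_split /=.
  apply: eq_bigr => y /andP[/negPf yx /negPf nexy]; rewrite fA /f yx nexy /=.
  by ring.
congr (_ <= 0); rewrite /local_deviation -/b -natr1 /=; field.
by rewrite gt_eqF.
Qed.

Lemma local_deviation_bound x :
  local_deviation x / k%:R +
  (beta1 R e x + (theta`_1 + 1) * (theta`_D + 1)) *
  ((k%:R + codegree) * beta1 R e x / codegree + k.+1%:R) <= 0.
Proof.
have k0 : 0 < k%:R :> R by rewrite ltr0n degree_gt0.
have m0 := codegree_gt0; have b0 := beta1_gt0 x.
have c0 : 0 <= beta1 R e x / codegree by rewrite divr_ge0 // ltW.
(* The weights beta_1(x) / m and 1 / k cancel the terms in theta_1 + theta_D. *)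
have := lerD (mulr_ge0_le0 c0 (vertex_form x))
  (mulr_ge0_le0 (ltW (_ : 0 < k%:R^-1)) (neighbour_form x)).
rewrite addr0 invr_gt0 => /(_ k0); congr (_ <= 0).
by rewrite -natr1; field; rewrite !gt_eqF.
Qed.

End TestVectors.

(** * Strong regularity as constant numbers of common neighbours *)

Section StronglyRegular.
Variables (T : finType) (e : rel T) (k : nat).
Hypotheses (e_simple : simple_graph e) (e_connected : connected_graph e).
Hypothesis e_regular : regular_graph e k.
Implicit Types (x y z : T).

Let e_sym : symmetric e. Proof. by case: e_simple. Qed.
Let e_irr : irreflexive e. Proof. by case: e_simple. Qed.

Lemma card_neighbours_gdist0 x y :
  #|[set z | e y z & gdist e x z == 0%N]| = e x y.
Proof.
have -> : [set z | e y z & gdist e x z == 0%N] =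
    if e x y then [set x] else set0.
  apply/setP=> z; rewrite inE (gdist_eq0 e_connected) e_sym.
  by case: (boolP (e x y)) => exy; rewrite !inE; case: eqVneq => [->|_];
     rewrite ?andbF // ?exy // (negPf exy).
by case: (e x y); rewrite ?cards1 ?cards0.
Qed.

Lemma card_neighbours_gdist1 x y :
  #|[set z | e y z & gdist e x z == 1%N]| = common e x y.
Proof.
by apply: eq_card => z; rewrite !inE (gdist_eq1 e_simple e_connected) andbC.
Qed.

Lemma card_neighbours_gdist2 x y : (forall z, gdist e x z <= 2)%N ->
  #|[set z | e y z & gdist e x z == 2%N]| = (k - e x y - common e x y)%N.
Proof.
move=> le2; rewrite -(card_neighbours_gdist0 x y) -(card_neighbours_gdist1 x y).
set n2 := #|_|; set n0 := #|_|; set n1 := #|_|.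
suff -> : k = (n0 + n1 + n2)%N by rewrite -addnA addKn addKn.
rewrite -(e_regular y) /n0 /n1 /n2 -!sum1_card.
rewrite ![\sum_(z in _) _]big_mkcond -!big_split.
apply: eq_bigr => z _; rewrite !inE; case: (e y z) => //=.
by case: gdist (le2 z) => [|[|[]]].
Qed.

Lemma strongly_regular_of_common (a c : nat) :
    (exists x, 2 <= ecc e x)%N -> (0 < c)%N ->
    (forall x y, e x y -> common e x y = a) ->
    (forall x y, y != x -> ~~ e x y -> common e x y = c) ->
  strongly_regular e.
Proof.
move=> [x0 ecc2] c0 adj nonadj.
have gdist_le2 x y : (gdist e x y <= 2)%N.
  case: (eqVneq y x) => [/eqP|yx].
    by rewrite -(gdist_eq0 e_connected) => /eqP ->.
  case: (boolP (e x y)) => [|nexy].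
    by rewrite -(gdist_eq1 e_simple e_connected) => /eqP ->.
  rewrite leq_eqVlt (gdist_eq2 e_simple e_connected) yx nexy.
  by rewrite (nonadj x y yx nexy) c0.
split; last first.
  apply/eqP; rewrite eqn_leq; apply/andP; split.
    by apply/bigmax_leqP => x _; apply/bigmax_leqP.
  exact: leq_trans ecc2 (leq_bigmax _).
(* The intersection array of diameter two; the default of [nth] supplies b_2 = 0. *)
split=> //; exists (fun i => nth 0 [:: 0; 1; c] i)%N,
  (fun i => nth 0 [:: 0; a; k - c] i)%N, (fun i => nth 0 [:: k; k - 1 - a] i)%N.
move=> x y /=.
have n0 := card_neighbours_gdist0 x y; have n1 := card_neighbours_gdist1 x y.
have n2 := card_neighbours_gdist2 y (gdist_le2 x).
have le2 := gdist_le2 x y; case: (ltngtP (gdist e x y) 1) => d1.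
- have d0 : gdist e x y = 0%N by case: gdist d1.
  move/eqP: (d0); rewrite (gdist_eq0 e_connected) => /eqP yx.
  rewrite d0 n0 n1 /= {}yx e_irr /common; split=> //.
    by apply: eq_card0 => z; rewrite inE andbF.
  by rewrite -(e_regular x); apply: eq_card => z; rewrite !inE andbb.
- have d2 : gdist e x y = 2%N by apply/eqP; rewrite eqn_leq le2.
  move/eqP: (d2); rewrite (gdist_eq2 e_simple e_connected) => /and3P[yx nexy _].
  have cE := nonadj x y yx nexy.
  rewrite d2 n2 cE (negPf nexy) subn0; split=> //; first exact: etrans n1 cE.
  apply: eq_card0 => z; rewrite !inE.
  by case: gdist (gdist_le2 x z) => [|[|[|?]]]; rewrite ?andbF.
- move/eqP: (d1); rewrite (gdist_eq1 e_simple e_connected) => exy.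
  rewrite d1 n1 n2 exy (adj _ _ exy); split=> //.
  by apply: etrans n0 _; rewrite exy.
Qed.

(** The two constants are the intersection numbers a_1 and c_2; diameter two puts every non-adjacent
    pair at distance two. *)
Lemma strongly_regular_common : strongly_regular e ->
  exists a c : nat, (forall x y, e x y -> common e x y = a) /\
    (forall x y, y != x -> ~~ e x y -> common e x y = c).
Proof.
move=> [[_ _ [c [a [b abc]]]] diam2]; exists (a 1%N), (c 2%N).
have gdist_le2 x y : (gdist e x y <= 2)%N.
  by rewrite -diam2; apply: leq_trans (leq_bigmax x); apply: leq_bigmax.
split=> x y => [exy|yx nexy]; rewrite -card_neighbours_gdist1.
  have d1 : gdist e x y = 1%N.
    by apply/eqP; rewrite (gdist_eq1 e_simple e_connected).
  by have [_ + _] := abc x y; rewrite d1.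
have d2 : gdist e x y = 2%N.
  move: yx nexy (gdist_le2 x y); rewrite -(gdist_eq0 e_connected).
  rewrite -(gdist_eq1 e_simple e_connected).
  by case: gdist => [|[|[]]].
by have [+ _ _] := abc x y; rewrite d2 => cE; apply: etrans cE.
Qed.
End StronglyRegular.

(** * The inequality and its equality case *)

Section EqualityCase.
Variables (R : rcfType) (T : finType) (e : rel T) (k : nat).
Hypotheses (e_simple : simple_graph e) (e_connected : connected_graph e).
Hypothesis e_regular : regular_graph e k.
Hypothesis e_not_complete : ~ complete_graph e.
Implicit Types (x y z : T).

Let e_sym : symmetric e. Proof. by case: e_simple. Qed.

Lemma common_self x : common e x x = k.
Proof. by rewrite -(e_regular x); apply: eq_card => z; rewrite !inE andbb. Qed.

(** The hypotheses say A^2 = k I + a A + c (J - I - A), with J the all-one matrix. Since t differs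
    from k, [g] has sum zero and J annihilates it. *)
Lemma eigenfunction_quadratic (g : T -> R) (t : R) (a c : nat) :
    (forall x y, e x y -> common e x y = a) ->
    (forall x y, y != x -> ~~ e x y -> common e x y = c) ->
    (forall y, \sum_z (e y z)%:R * g z = t * g y) -> (exists x, g x != 0) ->
    t != k%:R ->
  t ^+ 2 = k%:R + a%:R * t - c%:R * (t + 1).
Proof.
move=> adj nonadj gt [x gx0] tk.
have g0 : \sum_y g y = 0.
  have /eqP : (t - k%:R) * \sum_y g y = 0.
    rewrite mulrBl !mulr_sumr -(eq_bigr _ (fun y _ => gt y)) exchange_big.
    rewrite -sumrB big1 // => z _ /=; rewrite -mulr_suml.
    by under eq_bigr do rewrite e_sym; rewrite (degreeE R e_regular) subrr.
  by rewrite mulf_eq0 subr_eq0 (negPf tk) => /eqP.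
apply: (mulIf gx0).
have -> : t ^+ 2 * g x = \sum_z (common e x z)%:R * g z.
  rewrite expr2 -mulrA -gt mulr_sumr.
  transitivity (\sum_y \sum_z (e x y)%:R * (e y z)%:R * g z).
    apply: eq_bigr => y _; rewrite mulrCA -gt mulr_sumr.
    by apply: eq_bigr => z _; rewrite mulrA.
  rewrite exchange_big; apply: eq_bigr => z _ /=; rewrite commonE mulr_suml.
  by apply: eq_bigr => y _; rewrite (e_sym z).
have gN : \sum_(y | e x y) g y = t * g x.
  rewrite -gt big_mkcond; apply: eq_bigr => y _.
  by case: (e x y); rewrite ?mul1r ?mul0r.
rewrite (sum_by_adjacency e_simple _ x) common_self.
rewrite (eq_bigr (fun y => a%:R * g y)) => [|y /adj -> //].
rewrite [X in _ + X](eq_bigr (fun y => c%:R * g y)) => [|y /andP[yx nexy]];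
  last by rewrite nonadj.
rewrite -!mulr_sumr gN.
move: g0; rewrite (sum_by_adjacency e_simple _ x) gN => /eqP.
rewrite addrC addr_eq0 => /eqP ->; ring.
Qed.

Variables (D : nat) (theta : D.+1.-tuple R).
Hypothesis theta_decr : sorted >%R theta.
Hypothesis theta_eig : forall a : R, (a \in theta) = eigenvalue (adj_mx R e) a.
Hypothesis theta_0 : theta`_0 = k%:R.

Let P := theta`_1 + 1.
Let Q := theta`_D + 1.

Lemma local_deviation_ge0 x : 0 <= local_deviation R e k x.
Proof. by rewrite addr_ge0 // sumr_ge0 // => y _; rewrite sqr_ge0. Qed.

Lemma weight_gt0 x :
  0 < (k%:R + codegree R T k) * beta1 R e x / codegree R T k + k.+1%:R.
Proof.
have m0 := @codegree_gt0 R _ _ _ e_simple e_regular e_not_complete.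
have b0 := @beta1_gt0 R _ _ _ e_simple e_connected e_regular e_not_complete x.
by rewrite addr_gt0 ?ltr0n // mulr_gt0 ?invr_gt0 // mulr_gt0 // ltr_wpDl ?ler0n.
Qed.

Lemma beta1_eigenvalue_bound x : P * Q <= - beta1 R e x.
Proof.
have := local_deviation_bound e_simple e_connected e_regular e_not_complete
  theta_decr theta_eig theta_0 x.
rewrite -/P -/Q => H; rewrite -subr_le0 opprK addrC.
rewrite -(pmulr_lle0 _ (weight_gt0 x)).
apply: le_trans H; rewrite lerDr divr_ge0 ?ler0n //.
exact: local_deviation_ge0.
Qed.

(** Equality leaves V / k <= 0, so every square in V vanishes. The values are written with [P * Q]
    instead of beta_1(x) to make them visibly independent of x. *)
Lemma common_of_equality x : P * Q = - beta1 R e x ->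
  (forall y, e x y -> (common e x y)%:R = k%:R - 1 + P * Q) /\
  (forall y, y != x -> ~~ e x y ->
     (common e x y)%:R = - (k%:R * (P * Q)) / codegree R T k).
Proof.
move=> eqx.
have := local_deviation_bound e_simple e_connected e_regular e_not_complete
  theta_decr theta_eig theta_0 x.
rewrite -/P -/Q eqx subrr mul0r addr0 pmulr_lle0; last first.
  by rewrite invr_gt0 ltr0n (degree_gt0 R e_simple e_connected e_regular).
move=> dev_le0.
have /eqP : local_deviation R e k x = 0.
  by apply/eqP; rewrite eq_le dev_le0 local_deviation_ge0.
rewrite paddr_eq0 ?sumr_ge0 // => [/andP[/eqP N0 /eqP M0]|y _|y _];
  rewrite ?sqr_ge0 //.
split=> [y exy|y yx nexy].
  have /eqP := psumr_eq0P (fun y _ => sqr_ge0 _) N0 exy.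
  by rewrite sqrf_eq0 => /eqP ?; lra.
have /eqP := psumr_eq0P (fun y _ => sqr_ge0 _) M0 (introT andP (conj yx nexy)).
by rewrite sqrf_eq0 subr_eq0 => /eqP ->; rewrite mulrN opprK.
Qed.

Lemma strongly_regular_of_equality :
  (forall x, P * Q = - beta1 R e x) -> strongly_regular e.
Proof.
move=> PQ.
have [x0] : exists x : T, true.
  case: (pickP T) => [x _|T0]; first by exists x.
  by case: e_not_complete => x; have := T0 x.
have k0 := degree_gt0 R e_simple e_connected e_regular e_not_complete.
have [y0] : exists y0, e x0 y0.
  by move: k0; rewrite -(e_regular x0) => /card_gt0P[y]; rewrite inE; exists y.
have [y1 yx1 ney1] :=
  nonneighbour_exists R e_simple e_regular e_not_complete x0.
move=> exy0 _; have eqs x := common_of_equality (PQ x).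
have [adj0 non0] := eqs x0.
apply: (@strongly_regular_of_common _ _ k _ _ _
  (common e x0 y0) (common e x0 y1)) => //.
- by exists x0; apply: (ecc_ge2 R e_simple e_connected e_regular).
- rewrite -(ltr0n R) non0 // (PQ x0) mulrN opprK mulr_gt0 ?invr_gt0 //.
    by rewrite mulr_gt0 ?ltr0n // (beta1_gt0 R e_simple e_connected e_regular).
  exact: (codegree_gt0 R e_simple e_regular).
- by move=> x y exy; apply/eqP; rewrite -(eqr_nat R) adj0 // (eqs x).1.
by move=> x y yx nexy; apply/eqP; rewrite -(eqr_nat R) non0 // (eqs x).2.
Qed.

(** By Vieta, theta_1 + theta_D = a - c and theta_1 theta_D = c - k, whence [P * Q] = a - k + 1;
    counting over the neighbours of x gives beta_1(x) = k - 1 - a. *)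
Lemma equality_of_strongly_regular :
  strongly_regular e -> forall x, P * Q = - beta1 R e x.
Proof.
move=> srg x.
have [a [c [adj nonadj]]] := strongly_regular_common e_simple e_connected srg.
have b_gt0 : 0 < beta1 R e x.
  exact: (beta1_gt0 R e_simple e_connected e_regular).
have k0 := degree_gt0 R e_simple e_connected e_regular e_not_complete.
have bE : beta1 R e x = k%:R - 1 - a%:R.
  have kR0 : k%:R != 0 :> R by rewrite pnatr_eq0 -lt0n.
  apply: (mulfI kR0).
  rewrite (beta1_neighbours R e_simple e_connected e_regular e_not_complete).
  rewrite (eq_bigr (fun=> (k%:R - 1 - a%:R) * 1)) => [|y /adj ->];
    last by rewrite mulr1.
  by rewrite -mulr_sumr (sum_neighbours1 R e_regular) mulrC.
have PQ_lt0 : P * Q < 0.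
  by apply: le_lt_trans (beta1_eigenvalue_bound x) _; rewrite oppr_lt0.
have quadratic i : (0 < i <= D)%N ->
    theta`_i ^+ 2 = k%:R + a%:R * theta`_i - c%:R * (theta`_i + 1).
  move=> /andP[i0 iD].
  have theta_i : theta`_i \in theta by rewrite mem_nth ?size_tuple.
  have := theta_i; rewrite theta_eig => /eigenvalueP[w wE w0].
  apply: (eigenfunction_quadratic adj nonadj (adj_mx_eigenvector e_simple wE)).
    have /rV0Pn[u wu] := w0; exists (enum_val u); by rewrite enum_valK.
  rewrite -theta_0 nth_uniq ?size_tuple //; first by rewrite -lt0n.
  apply: sorted_uniq theta_decr; [exact: rev_trans lt_trans|exact: ltxx].
(* If D = 0, then theta_1 is the default 0 and theta_D is k, so [P * Q] would be k + 1,
   contradicting [PQ_lt0]. *)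
have D0 : (0 < D)%N.
  rewrite lt0n; apply: contraTN PQ_lt0 => D0; rewrite -leNgt.
  have -> : P = 1 by rewrite /P nth_default ?add0r // size_tuple (eqP D0).
  have -> : Q = k%:R + 1.
    by rewrite /Q -theta_0; congr (nth _ _ _ + _); apply/eqP.
  rewrite mul1r.
  by rewrite addr_ge0 ?ler0n.
have ne : theta`_1 != theta`_D.
  apply: contraTneq PQ_lt0 => E; rewrite -leNgt /P /Q E -expr2.
  exact: sqr_ge0.
have q1 := quadratic 1%N D0; have qD := quadratic D; rewrite D0 leqnn in qD.
have {}qD := qD isT.
have s : theta`_1 + theta`_D = a%:R - c%:R.
  have ne' : theta`_1 - theta`_D != 0 by rewrite subr_eq0.
  apply: (mulfI ne'); rewrite -subr_sqr q1 qD; ring.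
have p : theta`_1 * theta`_D = c%:R - k%:R.
  have -> : theta`_D = a%:R - c%:R - theta`_1 by rewrite -s; ring.
  by rewrite mulrBr -expr2 q1; ring.
have -> : P * Q = theta`_1 * theta`_D + (theta`_1 + theta`_D) + 1.
  by rewrite /P /Q; ring.
by rewrite s p bE; ring.
Qed.
End EqualityCase.

Theorem theorem3p1 (R : rcfType) (T : finType) (e : rel T) (k D : nat)
    (theta : D.+1.-tuple R)
    (e_simple : simple_graph e) (e_connected : connected_graph e)
    (e_regular : regular_graph e k) (e_not_complete : ~ complete_graph e)
    (theta_decr : sorted >%R theta)
    (theta_eig : forall a : R, (a \in theta) = eigenvalue (adj_mx R e) a)
    (theta_0 : theta`_0 = k%:R) :
  (forall x : T, (theta`_1 + 1) * (theta`_D + 1) <= - beta1 R e x) /\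
  ((forall x : T, (theta`_1 + 1) * (theta`_D + 1) = - beta1 R e x) <->
   strongly_regular e).
Proof.
split; first exact: beta1_eigenvalue_bound.
split; first exact: strongly_regular_of_equality.
exact: equality_of_strongly_regular.
Qed.
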